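(* Let $f:\mathbb{R}\to\mathbb{R}$ be a continuous function which is strictly convex or strictly concave, and let $A,C\subset\mathbb{R}$ be finite sets with $|A|\approx|C|$. Then $$|f(A)+C|^{10}\,|A+A|^9\gg\frac{|A|^{24}}{(\log|A|)^2}.$$ In particular, taking $C=f(A)$, $$\max\{|f(A)+f(A)|,\ |A+A|\}\gg\frac{|A|^{24/19}}{(\log|A|)^{2/19}}.$$
   Context: $f(A)=\{f(a):a\in A\}$, $X+Y=\{x+y:x\in X,y\in Y\}$. $X\ll Y$ means $X\le cY$ for some absolute constant $c>0$, $X\gg Y$ means $Y\ll X$, and $X\approx Y$ means $X\ll Y$ and $Y\ll X$; the hypothesis $|A|\approx|C|$ means $K^{-1}|A|\le|C|\le K|A|$ for a fixed constant $K$, and the implied constant in the conclusion may depend on $K$. Logarithms are to base 2. *)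

(* Defs.v *)
From HB Require Import structures.
From mathcomp Require Import all_boot all_order all_algebra finmap.
From mathcomp Require Import all_classical all_reals all_analysis.

Set Implicit Arguments.
Unset Strict Implicit.
Unset Printing Implicit Defensive.

Import Order.TTheory GRing.Theory Num.Theory.
Import numFieldNormedType.Exports.

Local Open Scope ring_scope.

Definition strictly_convex (R : realType) (f : R -> R) : Prop :=
  forall x y t : R, x != y -> 0 < t < 1 ->
    f (t * x + (1 - t) * y) < t * f x + (1 - t) * f y.

Definition strictly_concave (R : realType) (f : R -> R) : Prop :=
  forall x y t : R, x != y -> 0 < t < 1 ->
    t * f x + (1 - t) * f y < f (t * x + (1 - t) * y).

Definition image_fset (R : realType) (f : R -> R) (A : {fset R}) : {fset R} :=
  [fset f a | a in A]%fset.

Definition sumset (R : realType) (X Y : {fset R}) : {fset R} :=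
  [fset (x + y)%R | x in X, y in Y]%fset.

Definition rcard (R : realType) (X : {fset R}) : R := #|` X|%fset%:R.

Definition log2 (R : realType) (x : R) : R := ln x / ln 2.

(* Main.v *)
Require Import Defs.
From HB Require Import structures.
From mathcomp Require Import all_boot all_order all_algebra finmap.
From mathcomp Require Import all_classical all_reals all_analysis.
From mathcomp Require Import zify ring lra.
Import Order.TTheory GRing.Theory Num.Theory.
Import numFieldNormedType.Exports.
Local Open Scope ring_scope.

Set Implicit Arguments.
Unset Strict Implicit.
Unset Printing Implicit Defensive.

(** Passing to half of A, f is strictly monotone on A, so the translates of its
    graph are monotone chains, any two of which meet at most once by convexity.
    On a Cartesian product this gives the Szemeredi-Trotter bound by elementary
    means: in a grid of rectangular cells a monotone chain visits few cells, and
    inside a cell one counts pairs of points.  Hence, with F = |f(A) + C|, the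
    number of x having at least t representations x = a - b is
    O(F^2 |B|^2 / (|C| t^3)), which controls the energies
    E(A, B) << F |B|^(3/2), E_3(A) << F^2 |A| log |A|, and shows that the
    differences with at most O(F^2 |A| / E(A)) representations carry half of
    E(A).  Summing Cauchy-Schwarz for A + (A cap (A - s)) over these s and using
    the Katz-Koester inclusion gives
    |A|^2 E(A)^2 << E_3(A) (F^2 |A| / E(A)) E(A, A + A), and E(A) >= |A|^4 / |A + A|
    concludes. *)

(** * Finite sums and Cauchy-Schwarz over the natural numbers *)

Lemma sum_nat_eq (V : choiceType) (T : {fset V}) (z : V) (F : V -> nat) :
  (\sum_(x <- T) (z == x) * F x)%N = ((z \in T) * F z)%N.
Proof.
have [zT|zT] := boolP (z \in T).
  rewrite (big_fsetD1 z) //= eqxx big_seq big1 ?addn0 // => x.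
  by rewrite !inE eq_sym => /andP[/negbTE ->].
rewrite big_seq big1 // => x xT.
by case: eqP => // zx; rewrite zx xT in zT.
Qed.

Lemma card_fset_sep (V : choiceType) (T : {fset V}) (P : pred V) :
  #|` [fset x in T | P x]%fset| = (\sum_(x <- T) P x)%N.
Proof. by rewrite card_fset_sum1 -big_fset_condE /= big_mkcond. Qed.

Lemma big_fsetM (V W : choiceType) (X : {fset V}) (Y : {fset W})
    (F : V * W -> nat) :
  (\sum_(p <- (X `*` Y)%fset) F p = \sum_(x <- X) \sum_(y <- Y) F (x, y))%N.
Proof.
rewrite -big_allpairs /=.
apply: perm_big; apply: uniq_perm; rewrite ?fset_uniq //.
  by apply: allpairs_uniq; rewrite ?fset_uniq // => -[? ?] [? ?].
move=> [x y]; rewrite in_fsetM /=; apply/andP/allpairsP => [[xX yY]|].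
  by exists (x, y).
by case=> -[x' y'] /= [? ? [-> ->]].
Qed.

Lemma card_fsetM (V W : choiceType) (X : {fset V}) (Y : {fset W}) :
  #|` (X `*` Y)%fset| = (#|` X| * #|` Y|)%N.
Proof.
rewrite card_fset_sum1 (big_fsetM _ _ (fun=> 1%N)) -(card_fset_sum1 Y).
by rewrite big_const_seq iter_addn_0 count_predT mulnC.
Qed.

(** Cauchy-Schwarz without square roots: both sides, doubled, become double sums. Termwise,
    [(w i * w j) ^ 2] is at most the product of [x i * y j] and [x j * y i], so AM-GM applies. *)
Lemma leq_sqr_sum (I : Type) (s : seq I) (w x y : I -> nat) :
  (forall i, w i ^ 2 <= x i * y i)%N ->
  ((\sum_(i <- s) w i) ^ 2 <= (\sum_(i <- s) x i) * (\sum_(i <- s) y i))%N.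
Proof.
move=> wxy; rewrite -(leq_pmul2l (isT : 0 < 2)%N).
have -> : (2 * (\sum_(i <- s) w i) ^ 2 =
           \sum_(i <- s) \sum_(j <- s) 2 * (w i * w j))%N.
  rewrite -mulnn big_distrlr big_distrr /=.
  by apply: eq_bigr => i _; rewrite big_distrr.
have -> : (2 * ((\sum_(i <- s) x i) * (\sum_(i <- s) y i)) =
           \sum_(i <- s) \sum_(j <- s) (x i * y j + x j * y i))%N.
  under [RHS]eq_bigr do rewrite big_split /=.
  rewrite big_split /= big_distrlr /= mul2n -addnn; congr addn.
  by rewrite exchange_big.
apply: leq_sum => i _; apply: leq_sum => j _.
have := leq_mul (wxy i) (wxy j).
set u := (x i * y j)%N; set v := (x j * y i)%N => h.
have {}h : ((w i * w j) ^ 2 <= u * v)%N.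
  by apply: leq_trans (eq_leq _) (leq_trans h (eq_leq _)); rewrite /u /v; ring.
rewrite -(@leq_exp2r _ _ 2) //; have := nat_AGM2 u v.
move=> [h' _]; apply: leq_trans h'; lia.
Qed.

(* Cauchy-Schwarz applied to the sizes of the fibres of g. *)
Lemma leq_card_collisions (I V : choiceType) (U : {fset I}) (T : {fset V})
    (g : I -> V) :
  (forall u, u \in U -> g u \in T) ->
  (#|` U| ^ 2 <= #|` T| * \sum_(u <- U) \sum_(u' <- U) (g u == g u'))%N.
Proof.
move=> gT; pose N t := (\sum_(u <- U) (g u == t))%N.
have -> : #|` U| = (\sum_(t <- T) N t)%N.
  rewrite exchange_big card_fset_sum1 /= [LHS]big_seq [RHS]big_seq.
  apply: eq_bigr => u uU; have := sum_nat_eq T (g u) (fun=> 1%N).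
  by rewrite gT // mul1n => <-; apply: eq_bigr => t _; rewrite muln1.
have -> : (\sum_(u <- U) \sum_(u' <- U) (g u == g u') = \sum_(t <- T) N t ^ 2)%N.
  under [RHS]eq_bigr do rewrite -mulnn big_distrl /=.
  rewrite [RHS]exchange_big /= [LHS]big_seq [RHS]big_seq; apply: eq_bigr => u uU.
  rewrite sum_nat_eq gT // mul1n; apply: eq_bigr => u' _.
  by rewrite eq_sym.
rewrite card_fset_sum1; apply: leq_sqr_sum => t.
by rewrite mul1n.
Qed.

(** * Representation counts, additive energy and sumsets *)

Section Energy.
Variable R : realType.
Implicit Types A B D T : {fset R}.

Definition diffset A B : {fset R} := [fset (a - b)%R | a in A, b in B]%fset.

Lemma mem_diffset A B a b : a \in A -> b \in B -> a - b \in diffset A B.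
Proof. by move=> aA bB; apply/imfset2P; exists a => //; exists b. Qed.

Lemma mem_sumset A B a b : a \in A -> b \in B -> a + b \in sumset A B.
Proof. by move=> aA bB; apply/imfset2P; exists a => //; exists b. Qed.

Definition rep_set A B (x : R) : {fset R} := [fset b in B | (b + x)%R \in A]%fset.

Definition rep A B x : nat := #|` rep_set A B x|.

Definition energy A B : nat := (\sum_(a <- A) \sum_(a' <- A) rep B B (a - a'))%N.

Lemma repE A B x : rep A B x = (\sum_(a <- A) \sum_(b <- B) (a - b == x)%R)%N.
Proof.
rewrite /rep card_fset_sep exchange_big /=; apply: eq_bigr => b _.
have := sum_nat_eq A (b + x) (fun=> 1%N); rewrite muln1 => <-.
by apply: eq_bigr => a _; rewrite muln1 subr_eq addrC eq_sym.
Qed.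

Lemma rep_leqr A B x : (rep A B x <= #|` B|)%N.
Proof. by apply: fsubset_leq_card; apply: fset_sub. Qed.

Lemma rep_leql A B x : (rep A B x <= #|` A|)%N.
Proof.
rewrite repE card_fset_sum1; apply: leq_sum => a _.
have := sum_nat_eq B (a - x) (fun=> 1%N); rewrite muln1 => h.
apply: (@leq_trans (a - x \in B)); last exact: leq_b1.
by rewrite -h; apply: leq_sum => b _; rewrite muln1 !subr_eq addrC.
Qed.

Lemma sum_rep A B T (F : R -> nat) :
  (\sum_(x <- T) F x * rep A B x =
   \sum_(a <- A) \sum_(b <- B) (a - b \in T)%R * F (a - b)%R)%N.
Proof.
under eq_bigr do rewrite repE big_distrr /=.
rewrite exchange_big /=; apply: eq_bigr => a _.
under eq_bigr do rewrite big_distrr /=.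
rewrite exchange_big /=; apply: eq_bigr => b _.
by rewrite -sum_nat_eq; apply: eq_bigr => x _; rewrite mulnC.
Qed.

Lemma sum_rep_diffset A B (F : R -> nat) :
  (\sum_(x <- diffset A B) F x * rep A B x =
   \sum_(a <- A) \sum_(b <- B) F (a - b)%R)%N.
Proof.
rewrite sum_rep big_seq [RHS]big_seq; apply: eq_bigr => a aA.
rewrite big_seq [RHS]big_seq; apply: eq_bigr => b bB.
by rewrite mem_diffset // mul1n.
Qed.

Lemma energyE A B : energy A B =
  (\sum_(a <- A) \sum_(a' <- A) \sum_(b <- B) \sum_(b' <- B)
     (b - b' == a - a')%R)%N.
Proof. by apply: eq_bigr => a _; apply: eq_bigr => a' _; rewrite repE. Qed.

Lemma sum_rep_mul A B :
  (\sum_(s <- diffset A A) rep B B s * rep A A s)%N = energy A B.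
Proof. exact: sum_rep_diffset. Qed.

(** The energy equation [b - b' = a - a'] rearranges to [a - b = a' - b']. *)
Lemma sum_rep_sqr A B :
  (\sum_(x <- diffset A B) rep A B x ^ 2)%N = energy A B.
Proof.
under eq_bigr do rewrite -mulnn; rewrite sum_rep_diffset energyE.
apply: eq_bigr => a _; under eq_bigr do rewrite repE.
rewrite exchange_big; apply: eq_bigr => a' _; apply: eq_bigr => b _.
apply: eq_bigr => b' _; congr nat_of_bool.
by rewrite -[LHS]subr_eq0 -[RHS]subr_eq0; congr (_ == 0); ring.
Qed.

Lemma sum_rep_diff A B :
  (\sum_(x <- diffset A B) rep A B x)%N = (#|` A| * #|` B|)%N.
Proof.
have := sum_rep_diffset A B (fun=> 1%N); under eq_bigr do rewrite mul1n.
move=> ->; rewrite -card_fsetM card_fset_sum1.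
by rewrite (big_fsetM _ _ (fun=> 1%N)).
Qed.

(** Cauchy-Schwarz for the addition map on pairs: its collisions [a + b = a' + b'] become energy
    quadruples once two of the variables are swapped. *)
Lemma energy_sumset A B :
  ((#|` A| * #|` B|) ^ 2 <= #|` sumset A B| * energy A B)%N.
Proof.
rewrite -card_fsetM.
apply: leq_trans (@leq_card_collisions _ _ _ (sumset A B)
  (fun p => p.1 + p.2) _) (eq_leq _).
  by move=> [a b]; rewrite in_fsetM => /andP[? ?]; apply: mem_sumset.
congr muln; rewrite big_fsetM energyE; apply: eq_bigr => a _.
under eq_bigr do rewrite big_fsetM.
rewrite exchange_big /=; apply: eq_bigr => a' _.
rewrite exchange_big /=; apply: eq_bigr => b _.
apply: eq_bigr => b' _; congr nat_of_bool.
rewrite -[LHS]subr_eq0 -[RHS]subr_eq0 -[LHS]oppr_eq0; congr (_ == 0); ring.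
Qed.

(* Both sides count the quadruples of elements of A spanning a parallelogram
   with sides s and a - a', for a pair (a, a') of elements of A. *)
Lemma sum_energy_rep_set A :
  (\sum_(s <- diffset A A) energy A (rep_set A A s) <=
   \sum_(s <- diffset A A) rep A A s ^ 3)%N.
Proof.
have -> : (\sum_(s <- diffset A A) rep A A s ^ 3 =
           \sum_(a <- A) \sum_(a' <- A) rep A A (a - a') ^ 2)%N.
  by rewrite -(sum_rep_diffset A A (fun s => rep A A s ^ 2)%N);
     apply: eq_bigr => s _; rewrite expnSr.
rewrite exchange_big; apply: leq_sum => a _ /=.
rewrite exchange_big; apply: leq_sum => a' _ /=.
move: (a - a') => d.
have -> : (rep A A d ^ 2 = \sum_(b <- rep_set A A d) \sum_(e <- A) (e + d \in A)%R)%N.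
  rewrite -card_fset_sep big_const_seq iter_addn_0 count_predT -mulnn.
  by rewrite mulnC.
have -> : (\sum_(s <- diffset A A) rep (rep_set A A s) (rep_set A A s) d =
  \sum_(b <- rep_set A A d) \sum_(s <- diffset A A)
     ((b + s \in A) && (b + s + d \in A))%R)%N.
  rewrite exchange_big /=; apply: eq_bigr => s _.
  rewrite -card_fset_sep; congr #|` _|; apply/fsetP => b.
  rewrite !inE /= addrAC; do 4 case: (_ \in A) => //=.
apply: leq_sum => b bA.
(* With [b] fixed, [s] is recovered from [b + s], an element of [A] that stays in [A] after adding
   [d]. *)
rewrite -2!card_fset_sep; set S := [fset _ in _ | _]%fset.
have <- : #|` [fset (b + s)%R | s in S]%fset| = #|` S|.
  exact: card_imfset (addrI b).
apply: fsubset_leq_card; apply/fsubsetP => _ /imfsetP[s + ->].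
by rewrite !inE /= => /andP[_].
Qed.

(** If [b] and [b + s] are in [A], then [a + b] shifted by [s] equals [a + (b + s)], again in
    [A + A]. *)
Lemma katz_koester A s :
  (#|` sumset A (rep_set A A s)| <= rep (sumset A A) (sumset A A) s)%N.
Proof.
apply: fsubset_leq_card; apply/fsubsetP => _ /imfset2P[a aA [b bA ->]].
move: bA; rewrite !inE /= => /andP[bA bsA].
by rewrite mem_sumset //= -addrA mem_sumset.
Qed.

End Energy.

(** * Incidences of monotone chains with a grid *)

Section LevelSets.
Variable R : realType.
Implicit Types (A B C X Y S : {fset R}) (f : R -> R).

(** The 0-based position of [x] in the increasing order of [X]; quotients of ranks by [m.+1] cut [X]
    into blocks. *)
Definition fset_rank X x : nat := #|` [fset z in X | (z < x)%R]%fset|.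

Lemma fset_rank_homo X : {homo fset_rank X : x y / x <= y >-> (x <= y)%N}.
Proof.
move=> x y xy; apply: fsubset_leq_card; apply/fsubsetP => z.
by rewrite !inE /= => /andP[-> zx]; apply: lt_le_trans xy.
Qed.

Lemma fset_rank_ltn X x y :
  x \in X -> x < y -> (fset_rank X x < fset_rank X y)%N.
Proof.
move=> xX xy; apply: fproper_ltn_card; rewrite fproperE; apply/andP; split.
  apply/fsubsetP => z; rewrite !inE /= => /andP[-> zx]; exact: lt_trans xy.
by apply/fsubsetPn; exists x; rewrite !inE /= xX ?xy ?ltxx.
Qed.

Lemma fset_rank_leq X x : (fset_rank X x <= #|` X|)%N.
Proof. by apply: fsubset_leq_card; apply: fset_sub. Qed.

Lemma fset_rank_inj X : {in X &, injective (fset_rank X)}.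
Proof.
move=> x y xX yX xy; case: (ltgtP x y) => // [h|h].
  by have := fset_rank_ltn xX h; rewrite xy ltnn.
by have := fset_rank_ltn yX h; rewrite xy ltnn.
Qed.

Definition same_block X m : {fset R * R} :=
  [fset p in (X `*` X) | (p.1 < p.2)%R &&
    (fset_rank X p.1 %/ m.+1 == fset_rank X p.2 %/ m.+1)%N]%fset.

Lemma card_same_block X m : (#|` same_block X m| <= #|` X| * m)%N.
Proof.
rewrite /same_block card_fset_sep big_fsetM mulnC.
have -> : (m * #|` X| = \sum_(x <- X) m)%N.
  by rewrite big_const_seq iter_addn_0 count_predT.
rewrite big_seq [leqRHS]big_seq; apply: leq_sum => x xX /=.
rewrite -card_fset_sep; set S := [fset _ in _ | _]%fset.
rewrite -(size_iota (fset_rank X x).+1 m) -(size_map (fset_rank X) S).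
apply: uniq_leq_size.
  rewrite map_inj_in_uniq ?fset_uniq // => y z.
  by rewrite !inE /= => /andP[yX _] /andP[zX _]; apply: fset_rank_inj.
move=> _ /mapP[y + ->]; rewrite !inE /= => /and3P[yX xy /eqP eqb].
rewrite mem_iota fset_rank_ltn //=.
have := divn_eq (fset_rank X x) m.+1; have := divn_eq (fset_rank X y) m.+1.
have := ltn_pmod (fset_rank X y) (ltn0Sn m).
rewrite eqb; lia.
Qed.

(** Each fibre of [g] has a single last element, giving at most [G] such elements; any other element
    starts at least one counted pair. *)
Lemma card_leq_fibres S (g : R -> nat) G :
  {in S, forall a, g a < G}%N ->
  (#|` S| <= G + \sum_(a <- S) \sum_(a' <- S) ((a < a')%R && (g a == g a')))%N.
Proof.
move=> gG; pose last a := [forall a' : S, ~~ ((a < val a') && (g a == g (val a')))].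
have hlast : (#|` [fset a in S | last a]%fset| <= G)%N.
  rewrite -(size_iota 0 G) -(size_map g); apply: uniq_leq_size.
    rewrite map_inj_in_uniq ?fset_uniq // => y z.
    rewrite !inE /= => /andP[yS /forallP ly] /andP[zS /forallP lz] gyz.
    case: (ltgtP y z) => // [h|h].
      by have := ly [` zS]%fset; rewrite /= h gyz eqxx.
    by have := lz [` yS]%fset; rewrite /= h gyz eqxx.
  move=> _ /mapP[y + ->]; rewrite !inE /= => /andP[yS _].
  by rewrite mem_iota /= gG.
apply: leq_trans (leq_add hlast (leqnn _)).
rewrite card_fset_sep card_fset_sum1 -big_split /= big_seq [leqRHS]big_seq.
apply: leq_sum => a aS; have [//|/forallPn[a' /negPn h]] := boolP (last a).
by rewrite add0n (big_fsetD1 (val a')) ?(valP a') //= h.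
Qed.

(* The curves y = f (x + b) + c, with b in B and c in C, are monotone chains on
   the grid X * (f(A) + C): cut the grid into cells made of (m + 1)-blocks and
   (k + 1)-blocks.  A chain visits at most |X|/(m+1) + |Y|/(k+1) + 1 cells, and by
   the last hypothesis two points of a cell lie on at most one chain. *)
Lemma grid_incidence f A B C X m k :
  {in A &, {homo f : x y / x < y}} ->
  (forall a a' e e', a \in A -> a' \in A -> e \in A -> e' \in A ->
     a < a' -> a' - a = e' - e -> f a' - f a = f e' - f e -> a = e) ->
  (#|` C| * \sum_(x <- X) rep A B x <=
   #|` B| * #|` C| * (#|` X| %/ m.+1 + #|` sumset (image_fset f A) C| %/ k.+1 + 1)
   + (#|` X| * m) * (#|` sumset (image_fset f A) C| * k))%N.
Proof.
move=> finc finj; set Y := sumset _ _.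
have fY a c : a \in A -> c \in C -> f a + c \in Y.
  by move=> aA cC; apply: mem_sumset => //; apply/imfsetP; exists a.
pose u x := (fset_rank X x %/ m.+1)%N; pose v y := (fset_rank Y y %/ k.+1)%N.
pose G := (#|` X| %/ m.+1 + #|` Y| %/ k.+1 + 1)%N.
(* Both block indices are nondecreasing along a chain, so their sum [g] takes equal values only
   inside one cell, and [G] bounds the number of cells visited. *)
pose g b c a := (u (a - b)%R + v (f a + c)%R)%N.
pose S b := [fset a in A | (a - b)%R \in X]%fset.
pose pairs b c := (\sum_(a <- S b) \sum_(a' <- S b)
   ((a < a')%R && (g b c a == g b c a')))%N.
have -> : (#|` C| * \sum_(x <- X) rep A B x =
           \sum_(b <- B) \sum_(c <- C) #|` S b|)%N.
  rewrite (eq_bigr (fun x => 1 * rep A B x)%N); last by move=> x _; rewrite mul1n.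
  rewrite sum_rep exchange_big /= big_distrr /=; apply: eq_bigr => b _.
  rewrite big_const_seq iter_addn_0 count_predT mulnC; congr muln.
  by rewrite card_fset_sep; apply: eq_bigr => a _; rewrite muln1.
have step1 : (\sum_(b <- B) \sum_(c <- C) #|` S b| <=
  \sum_(b <- B) \sum_(c <- C) (G + pairs b c))%N.
  apply: leq_sum => b _; apply: leq_sum => c _.
  apply: card_leq_fibres => a _; rewrite /G addn1 ltnS /g.
  by apply: leq_add; apply: leq_div2r; apply: fset_rank_leq.
apply: (leq_trans step1); under eq_bigr do rewrite big_split /=.
rewrite big_split /=; apply: leq_add.
  under eq_bigr do rewrite big_const_seq iter_addn_0 count_predT.
  by rewrite big_const_seq iter_addn_0 count_predT /G; lia.
pose Z := [fset z in ((B `*` C) `*` (A `*` A)) |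
  [&& (z.2.1 - z.1.1)%R \in X, (z.2.2 - z.1.1)%R \in X,
      (z.2.1 < z.2.2)%R & g z.1.1 z.1.2 z.2.1 == g z.1.1 z.1.2 z.2.2]]%fset.
have -> : (\sum_(b <- B) \sum_(c <- C) pairs b c)%N = #|` Z|.
  rewrite card_fset_sep big_fsetM big_fsetM; apply: eq_bigr => b _.
  apply: eq_bigr => c _; rewrite big_fsetM /pairs /S.
  rewrite -big_fset_condE /= big_mkcond /=; apply: eq_bigr => a _.
  rewrite -big_fset_condE /= big_mkcond /=.
  case: ifP => aX; last by rewrite big1.
  by apply: eq_bigr => a' _; case: ifP.
(* [h] sends a curve and two of its points to the two grid points. Their horizontal and vertical
   gaps determine [a] by [finj], and then everything else. *)
pose h (z : (R * R) * (R * R)) := ((z.2.1 - z.1.1, z.2.2 - z.1.1),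
   (f z.2.1 + z.1.2, f z.2.2 + z.1.2)).
have <- : #|` [fset h z | z in Z]%fset| = #|` Z|.
  apply: card_in_imfset => -[[b c] [a a']] [[b2 c2] [e e']].
  rewrite !inE /= => /andP[/andP[_ /andP[aA a'A]] /and4P[_ _ aa' _]].
  move=> /andP[/andP[_ /andP[eA e'A]] _] [h1 h2 h3 h4].
  have ae : a = e.
    apply: (finj a a' e e') => //.
      by move: h1 h2; lra.
    by move: h3 h4; lra.
  move: h1 h2 h3 h4; rewrite -ae => h1 h2 h3 h4.
  have bb : b = b2 by lra.
  have cc : c = c2 by lra.
  have -> : a' = e' by lra.
  by rewrite bb cc.
apply: leq_trans (leq_mul (card_same_block X m) (card_same_block Y k)).
rewrite -card_fsetM; apply: fsubset_leq_card; apply/fsubsetP => _ /imfsetP[z + ->].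
case: z => [[b c] [a a']]; rewrite !inE /=.
move=> /andP[/andP[/andP[bB cC] /andP[aA a'A]] /and4P[aX a'X aa' /eqP gaa']].
rewrite aX a'X !fY //= ltrD2r aa' ltrD2r finc //=.
have hu : (u (a - b)%R <= u (a' - b)%R)%N.
  by apply: leq_div2r; apply: fset_rank_homo; rewrite lerD2r ltW.
have hv : (v (f a + c)%R <= v (f a' + c)%R)%N.
  by apply: leq_div2r; apply: fset_rank_homo; rewrite lerD2r ltW // finc.
move: gaa' hu hv; rewrite /g /u /v => *; apply/andP; split; apply/eqP; lia.
Qed.

End LevelSets.

(** * Second and third moments from a cubic level-set bound *)

Section Moments.
Variables (I : Type) (T : seq I) (r : I -> nat) (c Q : nat).
Hypothesis level_bound :
  forall t, (c * t ^ 3 * \sum_(x <- T) (t <= r x) <= Q)%N.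

Lemma sum_exp_dyadic D e :
  (\sum_(x <- T) (D <= r x) * r x ^ e <=
   \sum_(x <- T) (2 * D <= r x) * r x ^ e
   + (2 * D) ^ e * \sum_(x <- T) (D <= r x))%N.
Proof.
rewrite big_distrr -big_split /=; apply: leq_sum => x _.
have [h|h] := leqP (2 * D) (r x); first by rewrite mul1n; case: leqP; lia.
have [_|//] := leqP D (r x); rewrite mul1n muln1.
by case: e => // e'; rewrite leq_exp2r // ltnW.
Qed.

(** Induction over dyadic scales: the range from [D] to [2 * D] costs [4 * Q], and the tail beyond
    [2 * D] costs half of [8 * Q] because the factor [D] has doubled. *)
Lemma sum_sqr_tail J D : (forall x, r x < D * 2 ^ J)%N ->
  (c * D * \sum_(x <- T) (D <= r x) * r x ^ 2 <= 8 * Q)%N.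
Proof.
elim: J D => [|J IH] D rD.
  rewrite big1 ?muln0 // => x _.
  by have := rD x; rewrite expn0 muln1 ltnNge => /negbTE ->.
have {}IH := IH (2 * D)%N _.
have {}IH : (c * (2 * D) * \sum_(x <- T) (2 * D <= r x) * r x ^ 2 <= 8 * Q)%N.
  by apply: IH => x; have := rD x; rewrite expnS; lia.
have := level_bound D; have := sum_exp_dyadic D 2.
move: IH; set u := bigop _ _ _; set v := bigop _ _ _; set w := bigop _ _ _.
move=> h1 h2 h3; apply: leq_trans (leq_mul (leqnn (c * D)%N) h2) _.
have -> : (c * D * (u + (2 * D) ^ 2 * w) = c * D * u + 4 * (c * D ^ 3 * w))%N.
  by ring.
lia.
Qed.

(** For cubes the scales no longer decay: each of the [J] scales costs [8 * Q], which is the source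
    of the logarithm. *)
Lemma sum_cube_tail J D : (forall x, r x < D * 2 ^ J)%N ->
  (c * \sum_(x <- T) (D <= r x) * r x ^ 3 <= 8 * Q * J)%N.
Proof.
elim: J D => [|J IH] D rD.
  rewrite big1 ?muln0 // => x _.
  by have := rD x; rewrite expn0 muln1 ltnNge => /negbTE ->.
have {}IH : (c * \sum_(x <- T) (2 * D <= r x) * r x ^ 3 <= 8 * Q * J)%N.
  by apply: IH => x; have := rD x; rewrite expnS; lia.
have := level_bound D; have := sum_exp_dyadic D 3.
move: IH; set u := bigop _ _ _; set v := bigop _ _ _; set w := bigop _ _ _.
move=> h1 h2 h3; apply: leq_trans (leq_mul (leqnn c) h2) _.
have -> : (c * (u + (2 * D) ^ 3 * w) = c * u + 8 * (c * D ^ 3 * w))%N by ring.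
lia.
Qed.

Lemma sum_cube J : (forall x, r x < 2 ^ J)%N ->
  (c * \sum_(x <- T) r x ^ 3 <= 8 * Q * J)%N.
Proof.
move=> rJ; have h : (c * \sum_(x <- T) (1 <= r x) * r x ^ 3 <= 8 * Q * J)%N.
  by apply: sum_cube_tail => x; rewrite mul1n.
apply: leq_trans h; rewrite leq_mul2l leq_sum ?orbT // => x _.
by case: (r x) => // n; rewrite mul1n.
Qed.

Lemma sum_sqr_split D : (\sum_(x <- T) r x ^ 2 =
  \sum_(x <- T) (r x <= D) * r x ^ 2 + \sum_(x <- T) (D < r x) * r x ^ 2)%N.
Proof.
by rewrite -big_split; apply: eq_bigr => x _; case: leqP; rewrite /= ?mul1n ?addn0.
Qed.

Variable J : nat.
Hypothesis rJ : (forall x, r x < 2 ^ J)%N.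

Lemma sum_sqr_large D :
  (c * D.+1 * \sum_(x <- T) (D < r x) * r x ^ 2 <= 8 * Q)%N.
Proof.
apply: (@sum_sqr_tail J) => x; apply: leq_trans (rJ x) _.
by rewrite leq_pmull.
Qed.

(* Cut at D = E / (2N), so that the small multiplicities carry at most half of
   the sum of squares E. *)
Lemma sqr_sum_sqr N : (\sum_(x <- T) r x = N)%N -> (0 < N)%N ->
  (c * (\sum_(x <- T) r x ^ 2) ^ 2 <= 32 * N * Q)%N.
Proof.
move=> rN N0; set E := (\sum_(x <- T) r x ^ 2)%N.
pose D := (E %/ (2 * N))%N.
have hD1 : (2 * N * D <= E)%N by rewrite mulnC leq_divM.
have hD2 : (E < 2 * N * D.+1)%N by rewrite [ltnRHS]mulnC ltn_ceil // muln_gt0.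
have hs : (\sum_(x <- T) (r x <= D) * r x ^ 2 <= D * N)%N.
  rewrite -rN big_distrr; apply: leq_sum => x _ /=.
  by have [h|//] := leqP (r x) D; rewrite mul1n -mulnn leq_mul2r h orbT.
have := sum_sqr_large D; have := sum_sqr_split D; rewrite -/E.
move: hs; set u := bigop _ _ _; set v := bigop _ _ _ => hu hE hv.
have {}hE : (E <= 2 * v)%N by lia.
have := leq_mul (leqnn c) (leq_mul (ltnW hD2) hE).
rewrite mulnn => /leq_trans; apply.
have -> : (c * (2 * N * D.+1 * (2 * v)) = 4 * N * (c * D.+1 * v))%N by ring.
have -> : (32 * N * Q = 4 * N * (8 * Q))%N by ring.
by rewrite leq_mul2l hv orbT.
Qed.

(** The cutoff [D = 16 * Q %/ (c * E)] is the one for which [sum_sqr_large] leaves less than half of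
    [E] above it. *)
Lemma sum_sqr_small : (0 < c)%N -> (0 < \sum_(x <- T) r x ^ 2)%N ->
  exists D, (c * D * \sum_(x <- T) r x ^ 2 <= 16 * Q)%N /\
    (\sum_(x <- T) r x ^ 2 <= 2 * \sum_(x <- T) (r x <= D) * r x ^ 2)%N.
Proof.
move=> c0; set E := (\sum_(x <- T) r x ^ 2)%N => E0.
pose D := (16 * Q %/ (c * E))%N; exists D; split.
  by rewrite -mulnAC -[X in (X <= _)%N]mulnC leq_divM.
have hD : (16 * Q < c * E * D.+1)%N by rewrite [ltnRHS]mulnC ltn_ceil // muln_gt0 c0.
have := sum_sqr_large D; have := sum_sqr_split D; rewrite -/E.
set u := bigop _ _ _; set v := bigop _ _ _ => hE hv.
have : (c * D.+1 * (2 * v) < c * D.+1 * E)%N.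
  apply: leq_ltn_trans (leq_trans hD _); first by lia.
  by rewrite -mulnA [(E * _)%N]mulnC mulnA.
rewrite ltn_mul2l => /andP[_]; lia.
Qed.

End Moments.

(** * Szemeredi-Trotter type bound for popular differences *)

Section ConvexLevel.
Variable R : realType.
Implicit Types (A B C X : {fset R}) (f : R -> R).

Lemma card_sumset_ger A B a : a \in A -> (#|` B| <= #|` sumset A B|)%N.
Proof.
move=> aA; have <- : #|` [fset (a + b)%R | b in B]%fset| = #|` B|.
  exact: card_imfset (addrI a).
by apply: fsubset_leq_card; apply/fsubsetP => _ /imfsetP[b bB ->]; apply: mem_sumset.
Qed.

Lemma card_sumset_gel A B b : b \in B -> (#|` A| <= #|` sumset A B|)%N.
Proof.
move=> bB; have <- : #|` [fset (a + b)%R | a in A]%fset| = #|` A|.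
  exact: card_imfset (addIr b).
by apply: fsubset_leq_card; apply/fsubsetP => _ /imfsetP[a aA ->]; apply: mem_sumset.
Qed.

(* m and k make each of the three terms of grid_incidence coming from the number
   of visited cells at most a sixth of the number of incidences. *)
Lemma level_set_bound f A B C X t :
  {in A &, {homo f : x y / x < y}} ->
  (forall a a' e e', a \in A -> a' \in A -> e \in A -> e' \in A ->
     a < a' -> a' - a = e' - e -> f a' - f a = f e' - f e -> a = e) ->
  (forall x, x \in X -> t <= rep A B x)%N ->
  (#|` C| * t ^ 3 * #|` X| <=
     72 * (#|` sumset (image_fset f A) C| ^ 2 * #|` B| ^ 2))%N.
Proof.
move=> finc finj Xt; have finj' : {in A &, injective f}.
  move=> x y xA yA fxy; case: (ltgtP x y) => // h.
    by have := finc _ _ xA yA h; rewrite fxy ltxx.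
  by have := finc _ _ yA xA h; rewrite fxy ltxx.
have [t0|t0] := posnP t; first by rewrite t0 muln0.
have [->|/fset0Pn[x0 x0X]] := eqVneq X fset0; first by rewrite cardfs0 muln0.
have [->|/fset0Pn[c0 c0C]] := eqVneq C fset0; first by rewrite cardfs0.
have tA := leq_trans (Xt _ x0X) (rep_leql A B x0).
have tB := leq_trans (Xt _ x0X) (rep_leqr A B x0).
have /fset0Pn[a0 a0A] : A != fset0.
  by apply/eqP => A0; move: tA; rewrite A0 cardfs0; lia.
have imA : #|` image_fset f A| = #|` A| by apply: card_in_imfset.
have AF : (#|` A| <= #|` sumset (image_fset f A) C|)%N.
  by rewrite -imA; apply: card_sumset_gel c0C.
have CF : (#|` C| <= #|` sumset (image_fset f A) C|)%N.
  by apply: (@card_sumset_ger _ _ (f a0)); apply/imfsetP; exists a0.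
have X0 : (0 < #|` X|)%N by rewrite cardfs_gt0; apply/fset0Pn; exists x0.
have inc m k := leq_trans _ (@grid_incidence R f A B C X m k finc finj).
have {inc} : (forall m k, #|` C| * (t * #|` X|) <=
    #|` B| * #|` C| * (#|` X| %/ m.+1 +
       #|` sumset (image_fset f A) C| %/ k.+1 + 1)
   + (#|` X| * m) * (#|` sumset (image_fset f A) C| * k))%N.
  move=> m k; apply: inc; rewrite leq_mul2l; apply/orP; right.
  apply: (@leq_trans (\sum_(x <- X) t)%N).
    by rewrite big_const_seq iter_addn_0 count_predT.
  by rewrite big_seq [leqRHS]big_seq; apply: leq_sum => x /Xt.
move: AF CF X0 tA tB; set F := #|` sumset _ _|.
move: #|` A| #|` B| #|` C| #|` X| F => n b c x F nF cF x0' tn tb inc.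
(* When [t * x] is small, the trivial bounds of [c] and [t] by [F], and of [t] by [b], suffice.
   Otherwise the [+ 1] in the cell count is also at most a sixth of the incidences. *)
have [small|big] := ltnP (t * x) (6 * b).
  have h1 : (c * t ^ 3 * x = (t * x) * (c * (t * t)))%N by ring.
  rewrite h1; have h2 : (c * (t * t) <= F * (F * b))%N.
    by apply: leq_mul cF (leq_mul _ tb); apply: leq_trans tn nF.
  apply: leq_trans (leq_mul (ltnW small) h2) _.
  have -> : (6 * b * (F * (F * b)) = 6 * (F ^ 2 * b ^ 2))%N by ring.
  by rewrite leq_mul2r orbT.
pose m := (6 * b %/ t)%N; pose k := (6 * b * F %/ (t * x))%N.
have F0 : (0 < F)%N by lia.
have tx0 : (0 < t * x)%N by rewrite muln_gt0 t0.
have hm1 : (t * m <= 6 * b)%N by rewrite mulnC leq_divM.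
have hm2 : (6 * b < t * m.+1)%N by rewrite [ltnRHS]mulnC ltn_ceil.
have hk1 : (t * x * k <= 6 * b * F)%N by rewrite mulnC leq_divM.
have hk2 : (6 * b * F < t * x * k.+1)%N by rewrite [ltnRHS]mulnC ltn_ceil.
have hx : (6 * b * (x %/ m.+1) <= t * x)%N.
  apply: leq_trans (leq_mul (ltnW hm2) (leqnn _)) _.
  by rewrite -mulnA leq_mul2l [(m.+1 * _)%N]mulnC leq_divM orbT.
have hF : (6 * b * (F %/ k.+1) <= t * x)%N.
  rewrite -(leq_pmul2r F0) mulnAC.
  apply: leq_trans (leq_mul (ltnW hk2) (leqnn _)) _.
  by rewrite -mulnA leq_mul2l [(k.+1 * _)%N]mulnC leq_divM orbT.
have {}inc := inc m k.
have {hx hF big} : (6 * (b * c * (x %/ m.+1 + F %/ k.+1 + 1)) <= 3 * (c * (t * x)))%N.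
  have -> : (6 * (b * c * (x %/ m.+1 + F %/ k.+1 + 1)) =
    c * (6 * b * (x %/ m.+1) + 6 * b * (F %/ k.+1) + 6 * b))%N by ring.
  have -> : (3 * (c * (t * x)) = c * (3 * (t * x)))%N by ring.
  by rewrite leq_mul2l; apply/orP; right; lia.
move: inc; set u := (b * c * _)%N; set v := (x * m * _)%N => inc hu.
(* The visited cells account for at most half of the incidences, so the pair term [v] carries the
   rest; the constant is [72 = 2 * 6 * 6], with a 6 from each of [m] and [k]. *)
have h : (c * (t * x) <= 2 * v)%N by lia.
rewrite -(leq_pmul2r x0').
have -> : (c * t ^ 3 * x * x = c * (t * x) * (t * (t * x)))%N by ring.
apply: leq_trans (leq_mul h (leqnn _)) _.
have -> : (2 * v * (t * (t * x)) = 2 * x * F * ((t * m) * (t * x * k)))%N.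
  by rewrite /v; ring.
apply: leq_trans (leq_mul (leqnn _) (leq_mul hm1 hk1)) _.
by apply: eq_leq; ring.
Qed.

End ConvexLevel.

(** * Combining the energies, and reducing to monotone functions *)

Section MainBound.
Variable R : realType.
Implicit Types (A B C X : {fset R}) (f : R -> R).

(** The shape [16 * k1 ^ 2 * k2 ^ 2 * k3] of [combine_moment_bounds], where 8, 16 and 32 come from
    the third moment, the cutoff and the energy of [A] with [A + A], and 72 from the level sets. *)
Definition convexity_const : nat :=
  (16 * (8 * 72) ^ 2 * (16 * 72) ^ 2 * (32 * 72))%N.

(** The exponents are chosen to eliminate [E], [E3], [D] and [G]: the sixth power of the lower bound
    for [S * E] splits off [E ^ 2] and [((n * E) ^ 2) ^ 2], which regroup into [(c * E3) ^ 2],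
    [(c * D * E) ^ 2] and [c * G ^ 2]. *)
Lemma combine_moment_bounds (k1 k2 k3 n c F S J E E3 D G : nat) :
  (0 < n)%N ->
  (c * E3 <= k1 * (F ^ 2 * n ^ 2 * J))%N ->
  (c * D * E <= k2 * (F ^ 2 * n ^ 2))%N ->
  (c * G ^ 2 <= k3 * (F ^ 2 * n * S ^ 3))%N ->
  ((n * n) ^ 2 <= S * E)%N ->
  ((n * E) ^ 2 <= 4 * (E3 * (D * G)))%N ->
  (c ^ 5 * n ^ 19 <= 16 * k1 ^ 2 * k2 ^ 2 * k3 * (F ^ 10 * S ^ 9 * J ^ 2))%N.
Proof.
move=> n0 h1 h2 h3 h4 h5.
(* The three upper bounds together bring in [n ^ 9], to be cancelled. *)
have n9 : (0 < n ^ 9)%N by rewrite expn_gt0 n0.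
rewrite -(leq_pmul2r n9).
move: h4; rewrite -(@leq_exp2r _ _ 6) // => h4.
move: h5; rewrite -(@leq_exp2r _ _ 2) // => h5.
move: h1; rewrite -(@leq_exp2r _ _ 2) // => h1.
move: h2; rewrite -(@leq_exp2r _ _ 2) // => h2.
have {h4} : (c ^ 5 * n ^ 4 * n ^ 24 <= c ^ 5 * n ^ 4 * (S * E) ^ 6)%N.
  rewrite leq_mul2l; apply/orP; right; apply: leq_trans h4.
  by apply: eq_leq; ring.
have -> : (c ^ 5 * n ^ 4 * n ^ 24 = c ^ 5 * n ^ 19 * n ^ 9)%N by ring.
move=> /leq_trans; apply.
have -> : (c ^ 5 * n ^ 4 * (S * E) ^ 6 =
           c ^ 5 * S ^ 6 * E ^ 2 * ((n * E) ^ 2) ^ 2)%N by ring.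
apply: leq_trans (leq_mul (leqnn _) h5) _.
have -> : (c ^ 5 * S ^ 6 * E ^ 2 * (4 * (E3 * (D * G))) ^ 2 =
  16 * S ^ 6 * ((c * E3) ^ 2 * (c * D * E) ^ 2 * (c * G ^ 2)))%N by ring.
apply: leq_trans (leq_mul (leqnn _) (leq_mul (leq_mul h1 h2) h3)) _.
by apply: eq_leq; ring.
Qed.

(* Katz-Koester: A + (A :&: (A - s)) lies in (A + A) :&: (A + A - s), so
   Cauchy-Schwarz bounds the energy of A against each of its intersections with
   its shifts, whose sum over s is the third moment. *)
Lemma energy_small_leq A D :
  ((#|` A| * \sum_(s <- diffset A A) (rep A A s <= D) * rep A A s ^ 2) ^ 2 <=
   (\sum_(s <- diffset A A) rep A A s ^ 3) * (D * energy A (sumset A A)))%N.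
Proof.
rewrite big_distrr /= -sum_rep_mul.
pose y s := ((rep A A s <= D) * rep A A s ^ 2 * rep (sumset A A) (sumset A A) s)%N.
apply: (@leq_trans ((\sum_(s <- diffset A A) energy A (rep_set A A s)) *
                    (\sum_(s <- diffset A A) y s))).
  apply: leq_sqr_sum => s; have := energy_sumset A (rep_set A A s).
  move=> /leq_trans/(_ (leq_mul (katz_koester A s) (leqnn _))).
  rewrite -/(rep A A s) /y.
  have [_|_] := leqP (rep A A s) D; last by rewrite !mul0n muln0.
  rewrite !mul1n; set r := rep A A s => h.
  have -> : ((#|` A| * r ^ 2) ^ 2 = r ^ 2 * (#|` A| * r) ^ 2)%N by ring.
  apply: leq_trans (leq_mul (leqnn _) h) _.
  by apply: eq_leq; ring.
apply: leq_mul; first exact: sum_energy_rep_set.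
rewrite big_distrr; apply: leq_sum => s _; rewrite /y.
have [h|//] := leqP (rep A A s) D; rewrite mul1n -mulnn -mulnA.
by rewrite leq_mul // mulnC.
Qed.

Lemma monotone_convex_bound f A C :
  {in A &, {homo f : x y / x < y}} ->
  (forall a a' e e', a \in A -> a' \in A -> e \in A -> e' \in A ->
     a < a' -> a' - a = e' - e -> f a' - f a = f e' - f e -> a = e) ->
  (0 < #|` A|)%N -> (0 < #|` C|)%N ->
  (#|` C| ^ 5 * #|` A| ^ 19 <= convexity_const *
     (#|` sumset (image_fset f A) C| ^ 10 * #|` sumset A A| ^ 9
        * (trunc_log 2 #|` A|).+1 ^ 2))%N.
Proof.
move=> finc finj n0 c0; set F := #|` sumset _ C|; set J := (trunc_log 2 _).+1.
(* Stated for every [B], since it serves both [B = A] and [B = A + A]. *)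
have lev B t : (#|` C| * t ^ 3 * \sum_(x <- diffset A B) (t <= rep A B x) <=
    72 * (F ^ 2 * #|` B| ^ 2))%N.
  rewrite -card_fset_sep; apply: level_set_bound finc finj _ => x.
  by rewrite !inE => /andP[].
have repJ B x : (rep A B x < 2 ^ J)%N.
  by apply: leq_ltn_trans (rep_leql A B x) _; rewrite trunc_log_ltn.
have S0 : (0 < #|` sumset A A|)%N.
  have /fset0Pn[a aA] : A != fset0 by rewrite -cardfs_gt0.
  exact: leq_trans n0 (card_sumset_gel A aA).
have hE := energy_sumset A A.
have E0 : (0 < energy A A)%N.
  rewrite lt0n; apply/eqP => E0; move: hE.
  by rewrite E0 muln0 leqNgt expn_gt0 muln_gt0 n0.
have [] := sum_sqr_small (lev A) (repJ A) c0; first by rewrite sum_rep_sqr.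
move=> D; rewrite sum_rep_sqr => -[hD1 hD2].
have h3 := sum_cube (lev A) (repJ A).
have hG := sqr_sum_sqr (lev (sumset A A)) (repJ (sumset A A))
  (sum_rep_diff A (sumset A A)).
rewrite muln_gt0 n0 S0 sum_rep_sqr in hG; have {}hG := hG isT.
apply: (combine_moment_bounds n0 _ _ _ hE _).
- by apply: leq_trans h3 (eq_leq _); ring.
- by apply: leq_trans hD1 (eq_leq _); ring.
- by apply: leq_trans hG (eq_leq _); ring.
have := energy_small_leq A D; set w := bigop _ _ _ => hw.
apply: (@leq_trans (4 * (#|` A| * w) ^ 2)%N); last by rewrite leq_mul2l hw.
have -> : (4 * (#|` A| * w) ^ 2 = (#|` A| * (2 * w)) ^ 2)%N by ring.
by rewrite leq_exp2r // leq_mul2l hD2 orbT.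
Qed.

(** Increments over intervals of equal length strictly increase. If [a < e], then [a'] and [e] lie
    inside the interval from [a] to [e'] with complementary weights, and adding the two convexity
    inequalities gives [f a' + f e < f a + f e']. *)
Lemma strictly_convex_translate f a a' e e' : strictly_convex f ->
  a < a' -> a' - a = e' - e -> f a' - f a = f e' - f e -> a = e.
Proof.
move=> fcvx; wlog ae : a a' e e' / a < e.
  move=> wl aa' h1 h2; case: (ltgtP a e) => // h; first exact: (wl a a' e e').
  by apply/esym/(wl e e' a a') => //; lra.
move=> aa' h1 h2; exfalso.
pose t := (a' - a) / (e' - a).
have d0 : 0 < e' - a by lra.
have t01 : 0 < t < 1.
  by rewrite /t divr_gt0 ?ltr_pdivrMr //=; lra.
have ea : e' != a by rewrite gt_eqF //; lra.
have td : t * (e' - a) = a' - a by rewrite /t divfK // gt_eqF.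
have := fcvx _ _ _ ea t01.
have -> : t * e' + (1 - t) * a = a' by lra.
have t01' : 0 < 1 - t < 1 by lra.
have := fcvx _ _ _ ea t01'.
have -> : (1 - t) * e' + (1 - (1 - t)) * a = e by lra.
lra.
Qed.

(* Keep the points where f is below all its later values on A (f increases
   there), or their complement, where convexity forces f to decrease. *)
Lemma strictly_convex_monotone_half f A : strictly_convex f ->
  exists A', [/\ (A' `<=` A)%fset, (#|` A| <= 2 * #|` A'|)%N &
    {in A' &, {homo f : x y / x < y}} \/
    {in A' &, {homo (fun x => - f x) : x y / x < y}}].
Proof.
move=> fcvx; pose p a := [forall a' : A, (a < val a') ==> (f a < f (val a'))].
pose P := [fset a in A | p a]%fset; pose Q := [fset a in A | ~~ p a]%fset.
have cPQ : #|` A| = (#|` P| + #|` Q|)%N.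
  by rewrite !card_fset_sum1 (big_fsetID _ p).
have [h|h] := leqP #|` Q| #|` P|.
  exists P; split; [exact: fset_sub|by lia|left].
  move=> x y; rewrite !inE /= => /andP[_ /forallP px] /andP[yA _] xy.
  by have := px [` yA]%fset; rewrite /= xy.
exists Q; split; [exact: fset_sub|by lia|right].
move=> x y; rewrite !inE /= => _ /andP[_ /forallPn[z]] + xy.
rewrite negb_imply -leNgt => /andP[yz fzy]; rewrite ltrN2 ltNge.
apply/negP => fxy; move: (val z) yz fzy => {}z yz fzy.
pose t := (z - y) / (z - x).
(* Now [x < y < z] with [f y] at least both [f x] and [f z], which strict convexity forbids. *)
have d0 : 0 < z - x by lra.
have t01 : 0 < t < 1 by rewrite /t divr_gt0 ?ltr_pdivrMr //=; lra.
have xz : x != z by rewrite lt_eqF //; lra.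
have td : t * (z - x) = z - y by rewrite /t divfK // gt_eqF.
have := fcvx _ _ _ xz t01.
have -> : t * x + (1 - t) * z = y by lra.
have : t * f x <= t * f y by rewrite ler_pM2l //; lra.
have : (1 - t) * f z <= (1 - t) * f y by rewrite ler_pM2l //; lra.
lra.
Qed.

(** Replacing [f] and [C] by their negatives negates [f(A) + C]; this handles decreasing and concave
    functions. *)
Definition fset_opp C : {fset R} := [fset (- c)%R | c in C]%fset.

Lemma card_fset_opp C : #|` fset_opp C| = #|` C|.
Proof. exact: card_imfset oppr_inj. Qed.

Lemma card_sumset_opp f A C :
  (#|` sumset (image_fset (fun x => - f x) A) (fset_opp C)| <=
   #|` sumset (image_fset f A) C|)%N.
Proof.
rewrite -(card_fset_opp (sumset _ C)); apply: fsubset_leq_card.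
apply/fsubsetP => _ /imfset2P[_ /imfsetP[a aA ->] [_ /imfsetP[c cC ->] ->]].
apply/imfsetP; exists (f a + c); last by rewrite /= opprD.
by apply: mem_sumset => //; apply/imfsetP; exists a.
Qed.

Lemma fsubset_sumset A A' B B' :
  (A' `<=` A)%fset -> (B' `<=` B)%fset ->
  (#|` sumset A' B'| <= #|` sumset A B|)%N.
Proof.
move=> /fsubsetP sA /fsubsetP sB; apply: fsubset_leq_card.
by apply/fsubsetP => _ /imfset2P[a aA [b bB ->]]; apply: mem_sumset; auto.
Qed.

Lemma fsubset_image f A A' :
  (A' `<=` A)%fset -> (image_fset f A' `<=` image_fset f A)%fset.
Proof.
move=> /fsubsetP sA; apply/fsubsetP => _ /imfsetP[a aA ->].
by apply/imfsetP; exists a => //; apply: sA.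
Qed.

Lemma strictly_convex_bound f A C : strictly_convex f ->
  (0 < #|` A|)%N -> (0 < #|` C|)%N ->
  (#|` C| ^ 5 * #|` A| ^ 19 <= 2 ^ 19 * convexity_const *
     (#|` sumset (image_fset f A) C| ^ 10 * #|` sumset A A| ^ 9
        * (trunc_log 2 #|` A|).+1 ^ 2))%N.
Proof.
move=> fcvx n0 c0.
have [A' [sA cA mono]] := strictly_convex_monotone_half A fcvx.
have n0' : (0 < #|` A'|)%N by lia.
have key : (#|` C| ^ 5 * #|` A'| ^ 19 <= convexity_const *
     (#|` sumset (image_fset f A') C| ^ 10 * #|` sumset A' A'| ^ 9
        * (trunc_log 2 #|` A'|).+1 ^ 2))%N.
  case: mono => mono.
    apply: monotone_convex_bound => // a a' e e' _ _ _ _.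
    exact: strictly_convex_translate.
  rewrite -(card_fset_opp C).
  apply: leq_trans (monotone_convex_bound mono _ n0' _) _.
  - move=> a a' e e' _ _ _ _ aa' h1 h2.
    by apply: (strictly_convex_translate fcvx aa' h1); lra.
  - by rewrite card_fset_opp.
  apply: leq_mul (leqnn _) (leq_mul (leq_mul _ (leqnn _)) (leqnn _)).
  by rewrite leq_exp2r // card_sumset_opp.
have h19 : (#|` A| ^ 19 <= 2 ^ 19 * #|` A'| ^ 19)%N.
  by rewrite -expnMn leq_exp2r.
move: (2 ^ 19)%N convexity_const h19 key => k K h19 key.
apply: leq_trans (leq_mul (leqnn _) h19) _.
rewrite mulnCA -mulnA leq_mul2l; apply/orP; right.
apply: leq_trans key _; rewrite leq_mul2l; apply/orP; right.
apply: leq_mul; first apply: leq_mul; rewrite leq_exp2r //.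
- by apply: fsubset_sumset => //; apply: fsubset_image.
- exact: fsubset_sumset.
by rewrite ltnS leq_trunc_log // fsubset_leq_card.
Qed.

End MainBound.

(** * Passage to real cardinalities and logarithms *)

Section Main.
Variable R : realType.
Implicit Types (A C : {fset R}) (f : R -> R).

Lemma strictly_concaveN f : strictly_concave f -> strictly_convex (fun x => - f x).
Proof. by move=> fc x y t xy t01; have := fc x y t xy t01; lra. Qed.

Lemma convex_or_concave_bound : exists2 k : R, 0 < k &
  forall f A C, strictly_convex f \/ strictly_concave f ->
    (0 < #|` A|)%N -> (0 < #|` C|)%N ->
    rcard C ^+ 5 * rcard A ^+ 19 <=
    k * (rcard (sumset (image_fset f A) C) ^+ 10 * rcard (sumset A A) ^+ 9
          * (trunc_log 2 #|` A|).+1%:R ^+ 2).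
Proof.
have [k bound] : exists k : nat, forall f A C,
    strictly_convex f \/ strictly_concave f ->
    (0 < #|` A|)%N -> (0 < #|` C|)%N ->
    (#|` C| ^ 5 * #|` A| ^ 19 <= k * (#|` sumset (image_fset f A) C| ^ 10 *
      #|` sumset A A| ^ 9 * (trunc_log 2 #|` A|).+1 ^ 2))%N.
  exists (2 ^ 19 * convexity_const)%N => f A C fcc n0 c0.
  case: fcc => [fcvx|fcc]; first exact: strictly_convex_bound.
  rewrite -(card_fset_opp C).
  apply: leq_trans (strictly_convex_bound (strictly_concaveN fcc) n0 _) _.
    by rewrite card_fset_opp.
  apply: leq_mul (leqnn _) (leq_mul (leq_mul _ (leqnn _)) (leqnn _)).
  by rewrite leq_exp2r // card_sumset_opp.
exists k.+1%:R; first by rewrite ltr0n.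
move=> f A C fcc n0 c0; rewrite /rcard -!natrX -!natrM ler_nat.
by apply: leq_trans (bound f A C fcc n0 c0) _; apply: leq_mul.
Qed.

(** [f] or its negative is injective on half of [A]; this makes [C = f(A)] admissible with
    [K = 2]. *)
Lemma card_image_convex_or_concave f A :
  strictly_convex f \/ strictly_concave f ->
  (#|` A| <= 2 * #|` image_fset f A|)%N.
Proof.
have mono_card (g : R -> R) A' : {in A' &, {homo g : x y / x < y}} ->
    #|` image_fset g A'| = #|` A'|.
  move=> gm; apply: card_in_imfset => x y xA yA gxy; case: (ltgtP x y) => // h.
    by have := gm _ _ xA yA h; rewrite gxy ltxx.
  by have := gm _ _ yA xA h; rewrite gxy ltxx.
have oppim (g : R -> R) A' :
    #|` image_fset (fun x => - g x) A'| = #|` image_fset g A'|.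
  rewrite -(card_fset_opp (image_fset g A')); congr #|` _|; apply/fsetP => y.
  apply/imfsetP/imfsetP => [[a aA ->]|[_ /imfsetP[a aA ->] ->]].
    by exists (g a) => //; apply/imfsetP; exists a.
  by exists a.
have cvx (g : R -> R) : strictly_convex g -> (#|` A| <= 2 * #|` image_fset g A|)%N.
  move=> /(strictly_convex_monotone_half A)[A' [sA cA mono]].
  apply: leq_trans cA _; rewrite leq_mul2l /=.
  apply: leq_trans (fsubset_leq_card (fsubset_image g sA)).
  by case: mono => /mono_card; rewrite ?oppim => ->.
case=> [/cvx //|/strictly_concaveN/cvx]; by rewrite oppim.
Qed.

Lemma log2_ge1 (n : nat) : (1 < n)%N -> 1 <= log2 (n%:R : R).
Proof.
move=> n1; have l2 : 0 < ln (2 : R) by rewrite ln_gt0 // ltr1n.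
by rewrite /log2 ler_pdivlMr // mul1r ler_ln ?posrE ?ltr0n ?ler_nat // ltnW.
Qed.

(** The successor is absorbed by doubling because the logarithm is at least 1 for [n] at least 2. *)
Lemma trunc_log_log2 (n : nat) :
  (1 < n)%N -> (trunc_log 2 n).+1%:R <= 2 * log2 (n%:R : R).
Proof.
move=> n1; have l2 : 0 < ln (2 : R) by rewrite ln_gt0 // ltr1n.
have h : (trunc_log 2 n)%:R <= log2 (n%:R : R).
  rewrite /log2 ler_pdivlMr // mulr_natl -lnXn ?ltr0n //.
  rewrite -natrX ler_ln ?posrE ?ltr0n ?expn_gt0 //; last by lia.
  by rewrite ler_nat trunc_logP //; lia.
by have := log2_ge1 n1; rewrite -natr1; lra.
Qed.

Lemma powR_divn_exp (a : R) (p q : nat) :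
  0 <= a -> (0 < q)%N -> (a `^ (p%:R / q%:R)) ^+ q = a ^+ p.
Proof.
move=> a0 q0; rewrite -powR_mulrn ?powR_ge0 // -powRrM divfK ?powR_mulrn //.
by rewrite pnatr_eq0 -lt0n.
Qed.

End Main.

Theorem theorem1p2 (R : realType) :
  (forall K : R, 0 < K ->
    exists c : R, 0 < c /\
      forall (f : R -> R) (A C : {fset R}),
        continuous f ->
        strictly_convex f \/ strictly_concave f ->
        1 < rcard A ->
        K^-1 * rcard A <= rcard C -> rcard C <= K * rcard A ->
        c * (rcard A ^+ 24 / log2 (rcard A) ^+ 2)
          <= rcard (sumset (image_fset f A) C) ^+ 10 * rcard (sumset A A) ^+ 9)
  /\
  (exists c : R, 0 < c /\
    forall (f : R -> R) (A : {fset R}),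
      continuous f ->
      strictly_convex f \/ strictly_concave f ->
      1 < rcard A ->
      c * (rcard A `^ (24 / 19) / log2 (rcard A) `^ (2 / 19))
        <= Num.max (rcard (sumset (image_fset f A) (image_fset f A)))
                   (rcard (sumset A A))).
Proof.
have part1 : forall K : R, 0 < K -> exists c : R, 0 < c /\
    forall (f : R -> R) (A C : {fset R}),
      strictly_convex f \/ strictly_concave f ->
      1 < rcard A -> K^-1 * rcard A <= rcard C ->
      c * (rcard A ^+ 24 / log2 (rcard A) ^+ 2)
        <= rcard (sumset (image_fset f A) C) ^+ 10 * rcard (sumset A A) ^+ 9.
  move=> K K0; have [k k0 bound] := convex_or_concave_bound R.
  (* [K ^+ 5] pays for trading five factors [rcard C] for [rcard A], and 4 is the square of the 2 in
     [trunc_log_log2]. *)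
  have M0 : 0 < 4 * K ^+ 5 * k by rewrite !mulr_gt0 ?exprn_gt0.
  exists (4 * K ^+ 5 * k)^-1; split; first by rewrite invr_gt0.
  move=> f A C fcc A1 KC.
  have A1' : (1 < #|` A|)%N by move: A1; rewrite /rcard ltr1n.
  have C0 : (0 < #|` C|)%N.
    have : 0 < rcard C.
      by apply: lt_le_trans KC; rewrite mulr_gt0 ?invr_gt0 // (lt_trans ltr01).
    by rewrite /rcard ltr0n.
  have := bound f A C fcc (ltnW A1') C0.
  have L1 : 1 <= log2 (rcard A) := log2_ge1 R A1'.
  have JL : (trunc_log 2 #|` A|).+1%:R ^+ 2 <= (2 * log2 (rcard A)) ^+ 2.
    by rewrite lerXn2r ?nnegrE ?ler0n ?trunc_log_log2 //; lra.
  have AC : rcard A <= K * rcard C by rewrite -ler_pdivrMl.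
  have AC5 : rcard A ^+ 5 <= (K * rcard C) ^+ 5.
    by rewrite lerXn2r ?nnegrE ?mulr_ge0 ?ler0n // ltW.
  set FS := _ * rcard (sumset A A) ^+ 9 => main.
  have FS0 : 0 <= FS by rewrite mulr_ge0 ?exprn_ge0 ?ler0n.
  have L0 : 0 < log2 (rcard A) ^+ 2 by rewrite exprn_gt0 //; lra.
  rewrite ler_pdivrMl // ler_pdivrMr //.
  have -> : rcard A ^+ 24 = rcard A ^+ 5 * rcard A ^+ 19 by rewrite -exprD.
  apply: (@le_trans _ _ ((K * rcard C) ^+ 5 * rcard A ^+ 19)).
    by rewrite ler_wpM2r // exprn_ge0 ?ler0n.
  rewrite exprMn -[leLHS]mulrA.
  apply: (@le_trans _ _ (K ^+ 5 * (k * (FS * (2 * log2 (rcard A)) ^+ 2)))).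
    apply: ler_wpM2l; first by rewrite exprn_ge0 // ltW.
    by apply: le_trans main _; apply: ler_wpM2l; [exact: ltW|exact: ler_wpM2l].
  by rewrite le_eqVlt; apply/orP; left; apply/eqP; ring.
split=> [K K0|].
  have [c [c0 h]] := part1 K K0; exists c; split=> // f A C _ fcc A1 KC _.
  exact: h.
have [c [c0 h]] := part1 2 (ltr0n _ 2).
exists (c `^ (1%:R / 19%:R)); split; first by rewrite powR_gt0.
move=> f A _ fcc A1; set m := Num.max _ _.
have A1' : (1 < #|` A|)%N by move: A1; rewrite /rcard ltr1n.
have L1 : 1 <= log2 (rcard A) := log2_ge1 R A1'.
have m0 : 0 <= m by rewrite le_max ler0n.
(* Raising to the power 19 clears the fractional exponents, and [m ^+ 19] splits as
   [m ^+ 10 * m ^+ 9] to match the first part. *)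
rewrite -(@ler_pXn2r _ 19) ?nnegrE ?mulr_ge0 ?invr_ge0 ?powR_ge0 //.
rewrite !exprMn exprVn (powR_divn_exp 1 (ltW c0)) // expr1.
rewrite (powR_divn_exp 24 (ler0n _ _)) // (powR_divn_exp 2 (le_trans ler01 L1)) //.
have -> : m ^+ 19 = m ^+ 10 * m ^+ 9 by rewrite -exprD.
apply: le_trans (h f A (image_fset f A) fcc A1 _) _.
  rewrite /rcard ler_pdivrMl // -natrM ler_nat.
  exact: card_image_convex_or_concave.
by apply: ler_pM; rewrite ?exprn_ge0 ?ler0n // lerXn2r ?nnegrE ?ler0n // le_max lexx ?orbT.
Qed.
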